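(* Let $N\ge 2$ be an integer, let $a,b>0$ with $ab<1$, and let $\ell\in\mathbb{Z}$. Let $g=s_N$ be the $N$th order B-spline and let $t^{[\ell]}$ be the associated Laurent (trigonometric) polynomial $$t^{[\ell]}(x)=\sum_{k=-\lfloor N/a\rfloor}^{\lfloor N/a\rfloor}t^{[\ell]}_k\cos(2\pi kx),\qquad t^{[\ell]}_k=\int_{\mathbb{R}}g\left(y-\tfrac{a}{2}k\right)g\left(y+\tfrac{a}{2}k\right)\cos(2\pi b\ell y)\,dy .$$ Then for all $x\in[-\frac12,\frac12]$, $$t^{[\ell]}(x)=\frac1a\sum_{r\in\mathbb{Z}}\operatorname{sinc}^N\left(\frac{r-(x-ab\ell/2)}{a}\right)\operatorname{sinc}^N\left(\frac{r-(x+ab\ell/2)}{a}\right).$$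
   Context: B-splines: $s_1=\chi_{[-1/2,1/2]}$ and $s_N=s_1*s_{N-1}$ for $N\ge 2$. $\operatorname{sinc}(\xi)=\frac{\sin(\pi\xi)}{\pi\xi}$ for $\xi\ne 0$, and $\operatorname{sinc}(0)=1$. *)

(* Defs.v *)
From HB Require Import structures.
From mathcomp Require Import all_boot all_order all_algebra.
From mathcomp Require Import all_classical all_reals all_analysis.

Set Implicit Arguments.
Unset Strict Implicit.
Unset Printing Implicit Defensive.

Import Order.TTheory GRing.Theory Num.Theory.
Import numFieldNormedType.Exports.

Local Open Scope classical_set_scope.
Local Open Scope ring_scope.

Definition convolution (R : realType) (f g : R -> R) (x : R) : R :=
  \int[lebesgue_measure]_y (f y * g (x - y)).

Definition box (R : realType) : R -> R := \1_(`[- 2^-1, 2^-1]).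

(* bspline N is s_N for N >= 1; bspline 0 is a junk value (equal to s_1). *)
Definition bspline (R : realType) (N : nat) : R -> R :=
  iter N.-1 (convolution (@box R)) (@box R).

Definition sinc (R : realType) (xi : R) : R :=
  if xi == 0 then 1 else sin (pi * xi) / (pi * xi).

Definition t_coef (R : realType) (g : R -> R) (a b : R) (l k : int) : R :=
  \int[lebesgue_measure]_y
    (g (y - a / 2 * k%:~R) * g (y + a / 2 * k%:~R)
     * cos (2 * pi * b * l%:~R * y)).

(* Num.truncn is the floor on nonnegative reals. With K = floor (N / a), the
   indices k = -K, ..., K are enumerated as k = i - K for i < 2K + 1. *)
Definition t_poly (R : realType) (N : nat) (a b : R) (l : int) (x : R) : R :=
  let K := Num.truncn (N%:R / a) in
  \sum_(i < (2 * K).+1)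
    let k := i%:Z - K%:Z in
    t_coef (bspline N) a b l k * cos (2 * pi * k%:~R * x).

(* Value of an absolutely convergent sum of reals over an arbitrary index type,
   as the difference of the sums of the positive and negative parts; it is only
   meaningful when summable [set: I] (EFin \o f) holds. *)
Definition rsum (R : realType) (I : choiceType) (f : I -> R) : R :=
  fine (\esum_(i in [set: I]) ((EFin \o f)^\+ i)
        - \esum_(i in [set: I]) ((EFin \o f)^\- i))%E.

(* Main.v *)
(* Write g = s_N and theta = x + a b l / 2.  Since the Fourier transform of g is sinc^N, the
   partial sums of the right-hand side are
     \sum_r F r / a = \int g(y) \int g(y + a u) cos (2 pi theta u + 2 pi b l y) D(u) du dy
   with D a Dirichlet kernel, and after a translation the left-hand side is
     t(x) = \int g(y) \sum_k g(y + a k) cos (2 pi theta k + 2 pi b l y) dy.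
   Adding the first n partial sums replaces D by the Fejer kernel K_n.  It is nonnegative,
   1-periodic, has integral n over a period and satisfies K_n(u) sin^2 (pi u) <= 1.  As g is
   Lipschitz for N >= 2 and |u| <= e + sin^2 (pi u) / e on the period, the inner integral
   divided by n tends to the inner sum uniformly in y: this is Poisson summation in the
   Cesaro sense.  The series converges absolutely because sinc^2 decays quadratically, so its
   sum is the limit of its Cesaro means. *)
Require Import Defs.
From HB Require Import structures.
From mathcomp Require Import all_boot all_order all_algebra.
From mathcomp Require Import all_classical all_reals all_analysis.
From mathcomp Require Import measurable_realfun ring lra zify.
Import Order.TTheory GRing.Theory Num.Theory.
Import numFieldNormedType.Exports.
Local Open Scope classical_set_scope.
Local Open Scope ring_scope.

(** * Affine substitution in Lebesgue integrals *)

Section affine_change_of_variables.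
Context {R : realType}.
Notation mu := (@lebesgue_measure R).

Lemma measurable_affine (c a : R) (D : set R) :
  measurable_fun D (fun u : R => c + a * u).
Proof.
apply: measurable_funTS; apply: continuous_measurable_fun => x.
by apply: cvgD; [exact: cvg_cst|apply: cvgM; [exact: cvg_cst|exact: cvg_id]].
Qed.

(** The scaled pushforward [nu] gives half-open intervals their length, and Lebesgue measure is the
    only measure that does. *)
Lemma lebesgue_measure_affine (c a : R) (A : set R) : 0 < a -> measurable A ->
  mu A = (a%:E * mu ((fun u : R => (c + a * u)%R) @^-1` A))%E.
Proof.
move=> a0 mA.
pose phi : measurableTypeR R -> measurableTypeR R := fun u => c + a * u.
have mphi : measurable_fun setT phi by exact: measurable_affine.
pose nu := mscale (NngNum (ltW a0)) (pushforward mu phi).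
rewrite (_ : (_ * _)%E = nu mphi A) //.
apply: lebesgue_measure_unique => //= _ [[x y]] _ <-.
rewrite /nu /mscale/= /pushforward.
rewrite (_ : phi @^-1` _ = `](x - c) / a, (y - c) / a]%classic); last first.
  apply/seteqP; split => u /=; rewrite !in_itv/= ltr_pdivrMr// ler_pdivlMr// /phi;
   by move=> /andP[? ?]; apply/andP; split; lra.
rewrite !lebesgue_measure_itv/= !lte_fin ltr_pM2r ?invr_gt0// ltrD2r.
case: ifPn => xy; last by rewrite mule0.
by rewrite -!EFinD -EFinM; congr (_%:E); field; rewrite gt_eqF.
Qed.

Lemma ge0_integral_affine (c a : R) (f : R -> \bar R) : 0 < a ->
  measurable_fun setT f -> (forall x, 0 <= f x)%E ->
  (\int[mu]_x f x = a%:E * \int[mu]_u f (c + a * u)%R)%E.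
Proof.
move=> a0 mf f0.
pose phi : measurableTypeR R -> measurableTypeR R := fun u => c + a * u.
have mphi : measurable_fun setT phi by exact: measurable_affine.
pose nu := mscale (NngNum (ltW a0)) (pushforward mu phi).
transitivity (\int[nu mphi]_x f x)%E.
  apply: eq_measure_integral => A mA _.
  exact: lebesgue_measure_affine.
by rewrite ge0_integral_mscale//= ge0_integral_pushforward.
Qed.

Lemma Rintegral_affine (c a : R) (f : R -> R) : 0 < a ->
  measurable_fun setT f ->
  \int[mu]_x f x = a * \int[mu]_u f (c + a * u).
Proof.
move=> a0 mf; have mf' : measurable_fun setT (EFin \o f) by exact/measurable_EFinP.
rewrite /Rintegral [X in fine X = _]integralE.
rewrite (ge0_integral_affine c a)//; last exact: measurable_funepos.
rewrite [X in (_ - X)%E](ge0_integral_affine c a)//; last exact: measurable_funeneg.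
rewrite -[X in X * _]/(fine a%:E).
(* The integrals of the positive and negative parts may be infinite; [fine] then gives 0 on both
   sides, so the factor [a] comes out in every case. *)
have E (p q : \bar R) : (0 <= p)%E -> (0 <= q)%E ->
    fine (a%:E * p - a%:E * q)%E = fine a%:E * fine (p - q)%E.
  move: p q => [p| |] [q| |]//= p0 q0; rewrite ?mulr0 ?gt0_muley ?lte_fin//=.
  by rewrite mulrBr.
rewrite E; last 2 first.
- exact: integral_ge0.
- exact: integral_ge0.
rewrite [X in _ = _ * fine X]integralE.
by congr (_ * fine (_ - _)%E); apply: eq_integral => u _; rewrite ?funeposE ?funenegE.
Qed.

Lemma integrable_affine (c a : R) (f : R -> R) : 0 < a ->
  mu.-integrable setT (EFin \o f) ->
  mu.-integrable setT (EFin \o (fun u => f (c + a * u))).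
Proof.
move=> a0 /integrableP[mf foo]; apply/integrableP; split.
  apply/measurable_EFinP; apply: (@measurableT_comp _ _ _ _ _ _ f).
    exact/measurable_EFinP.
  exact: measurable_affine.
move: foo; rewrite (ge0_integral_affine c a)//; last exact: measurableT_comp.
set J := integral _ _ _ => Jfoo.
suff : (J < +oo)%E by [].
have : (0 <= J)%E by exact: integral_ge0.
by case: J Jfoo => [r| |]//=; rewrite ?ltry// gt0_muley// lte_fin.
Qed.

End affine_change_of_variables.

(** * B-splines: bounds, support, Lipschitz continuity *)

Section bspline_theory.
Context {R : realType}.
Notation mu := (@lebesgue_measure R).
Implicit Types (f g h : R -> R).

(** Stated for a general measure so that it also covers the product measure in the Fubini argument
    for the Fourier transform. *)
Lemma integrable_mul_bounded d (T : measurableType d)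
    (nu : {measure set T -> \bar R}) (g h : T -> R) (M : R) : nu.-integrable setT (EFin \o g) ->
  measurable_fun setT h -> (forall x, `|h x| <= M) ->
  nu.-integrable setT (EFin \o (fun x => g x * h x)).
Proof.
move=> ig mh hM.
rewrite (_ : EFin \o _ = ((EFin \o g) \* (EFin \o h))%E); last first.
  by apply/funext => x /=; rewrite EFinM.
apply: integrableMl => //; exists M; split; first exact: num_real.
by move=> N MN x _; exact: le_trans (hM x) (ltW MN).
Qed.

Lemma integrable_Rsub f g : mu.-integrable setT (EFin \o f) ->
  mu.-integrable setT (EFin \o g) ->
  mu.-integrable setT (EFin \o (fun x => f x - g x)).
Proof.
move=> fi gi; rewrite (_ : EFin \o _ = ((EFin \o f) \- (EFin \o g))%E).
  exact: integrableB.
by apply/funext => x /=; rewrite EFinB.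
Qed.

Lemma integrable_Radd f g : mu.-integrable setT (EFin \o f) ->
  mu.-integrable setT (EFin \o g) ->
  mu.-integrable setT (EFin \o (fun x => f x + g x)).
Proof.
move=> fi gi; rewrite (_ : EFin \o _ = ((EFin \o f) \+ (EFin \o g))%E).
  exact: integrableD.
by apply/funext.
Qed.

Lemma integrable_Rscale f (k : R) : mu.-integrable setT (EFin \o f) ->
  mu.-integrable setT (EFin \o (fun x => k * f x)).
Proof.
move=> fi; rewrite (_ : EFin \o _ = (fun x => k%:E * (EFin \o f) x)%E).
  exact: integrableZl.
by apply/funext => x /=; rewrite EFinM.
Qed.

Lemma integrable_Rsum (I : Type) (s : seq I) (F : I -> R -> R) :
  (forall i, mu.-integrable setT (EFin \o F i)) ->
  mu.-integrable setT (EFin \o (fun x => \sum_(i <- s) F i x)).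
Proof.
move=> Fi; rewrite (_ : EFin \o _ = (fun x => \sum_(i <- s) (EFin \o F i) x)%E).
  exact: integrable_sum.
by apply/funext => x /=; rewrite sumEFin.
Qed.

Lemma Rintegral_sum (I : Type) (s : seq I) (F : I -> R -> R) :
  (forall i, mu.-integrable setT (EFin \o F i)) ->
  \int[mu]_x (\sum_(i <- s) F i x) = \sum_(i <- s) \int[mu]_x F i x.
Proof.
move=> Fi; elim: s => [|i s IH].
  under eq_Rintegral do rewrite big_nil.
  by rewrite Rintegral_cst// mul0r big_nil.
under eq_Rintegral do rewrite big_cons.
by rewrite RintegralD ?IH ?big_cons//; exact: integrable_Rsum.
Qed.

Lemma measurable_cos_affine (p q : R) :
  measurable_fun setT (fun y : R => cos (p * y + q)).
Proof.
apply: continuous_measurable_fun => x; apply: continuous_comp; last exact: continuous_cos.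
by apply: cvgD; [apply: cvgM; [exact: cvg_cst|exact: cvg_id]|exact: cvg_cst].
Qed.

Lemma boxE (x : R) : box x = if - 2^-1 <= x <= 2^-1 then 1 else 0.
Proof. by rewrite /box indicE mem_setE/= in_itv/=; case: ifPn. Qed.

Lemma measurable_box : measurable_fun setT (@box R).
Proof. exact: measurable_indic. Qed.

Lemma integrable_box : mu.-integrable setT (EFin \o (@box R)).
Proof. exact: integrable_indic_itv. Qed.

Lemma box_ge0 (x : R) : 0 <= box x.
Proof. by rewrite boxE; case: ifP. Qed.

Lemma box_le1 (x : R) : box x <= 1.
Proof. by rewrite boxE; case: ifP. Qed.

Lemma Rintegral_box : \int[mu]_x (box x) = 1.
Proof.
rewrite /Rintegral integral_indic//= setIT lebesgue_measure_itv/= lte_fin.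
by rewrite ifT; [rewrite -EFinD/=; lra|lra].
Qed.

Lemma bspline1 : @bspline R 1 = @box R. Proof. by []. Qed.

Lemma bsplineSS n : @bspline R n.+2 = convolution (@box R) (@bspline R n.+1).
Proof. by []. Qed.

Lemma measurable_box_shift g : measurable_fun setT g ->
  measurable_fun [set: R * R] (fun z : R * R => box z.2 * g (z.1 - z.2)).
Proof.
move=> mg; apply: measurable_funM.
  exact: (measurableT_comp measurable_box).
by apply: (measurableT_comp mg); exact: measurable_funB.
Qed.

Lemma integrable_box_shift g x (M : R) : measurable_fun setT g ->
  (forall x, `|g x| <= M) ->
  mu.-integrable setT (EFin \o (fun y => box y * g (x - y))).
Proof.
move=> mg gM; apply: (integrable_mul_bounded _ _ _ _ _ M) => //.
- exact: integrable_box.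
- by apply: (measurableT_comp mg); exact: measurable_funB.
Qed.

Lemma measurable_convolution_box g : measurable_fun setT g -> (forall x, 0 <= g x) ->
  measurable_fun setT (convolution (@box R) g).
Proof.
move=> mg g0; rewrite (_ : convolution _ _ = fine \o
  (fun x => \int[mu]_y (box y * g (x - y))%:E)%E)//.
apply: measurableT_comp; first exact: fine_measurable.
apply: (@measurable_fun_fubini_tonelli_F _ _ _ _ _ mu
  (fun z : R * R => (box z.2 * g (z.1 - z.2))%:E)) => //=.
- apply/measurable_EFinP.
  exact: measurable_box_shift.
- by move=> z; rewrite lee_fin mulr_ge0// box_ge0.
Qed.

(** The facts are carried through one induction because they feed each other: Tonelli gives
    measurability of the next convolution from nonnegativity, and the upper bound holds because
    convolving with a box of mass 1 is averaging. Each convolution widens the support by 1/2 on both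
    sides. *)
Lemma bsplineP n : [/\ measurable_fun setT (@bspline R n.+1),
  (forall x, 0 <= @bspline R n.+1 x <= 1) &
  forall x, n.+1%:R / 2 < `|x| -> @bspline R n.+1 x = 0].
Proof.
elim: n => [|n [mg g01 gsupp]].
  split; first exact: measurable_box.
    by move=> x; rewrite bspline1 box_ge0 box_le1.
  by move=> x; rewrite bspline1 boxE ltr_normr; case: ifPn => // /andP[? ?] /orP[?|?]; lra.
have gM x : `|@bspline R n.+1 x| <= 1.
  by have /andP[? ?] := g01 x; rewrite ger0_norm.
split.
- rewrite bsplineSS; apply: measurable_convolution_box => // x.
  by have /andP[] := g01 x.
- move=> x; rewrite bsplineSS /convolution; apply/andP; split.
    apply: Rintegral_ge0 => y _; apply: mulr_ge0; first exact: box_ge0.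
    by have /andP[] := g01 (x - y).
  rewrite -[leRHS]Rintegral_box; apply: le_Rintegral => //.
  + exact: (integrable_box_shift _ _ 1).
  + exact: integrable_box.
  + move=> y _; rewrite -[leRHS]mulr1 ler_wpM2l// ?box_ge0//.
    by have /andP[] := g01 (x - y).
- move=> x xn; rewrite bsplineSS /convolution.
  transitivity (\int[mu]_(y in setT) (0 : R)); last by rewrite Rintegral_cst ?mul0r.
  apply: eq_Rintegral => y _; rewrite boxE; case: ifPn => [/andP[y1 y2]|_]; last by rewrite mul0r.
  rewrite mul1r gsupp//; move: xn; rewrite !ltr_normr -[n.+2]addn1 natrD.
  by move=> /orP[xn|xn]; apply/orP; [left|right]; lra.
Qed.

Lemma measurable_bspline n : measurable_fun setT (@bspline R n.+1).
Proof. by have [] := bsplineP n. Qed.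

Lemma bspline_ge0 n x : 0 <= @bspline R n.+1 x.
Proof. by have [_ /(_ x)/andP[]] := bsplineP n. Qed.

Lemma bspline_norm n x : `|@bspline R n.+1 x| <= 1.
Proof. by rewrite ger0_norm ?bspline_ge0//; have [_ /(_ x)/andP[]] := bsplineP n. Qed.

Lemma bspline_supp n x : n.+1%:R / 2 < `|x| -> @bspline R n.+1 x = 0.
Proof. by have [_ _] := bsplineP n; exact. Qed.

Lemma integrable_bspline n : mu.-integrable setT (EFin \o @bspline R n.+1).
Proof.
rewrite (_ : @bspline R n.+1 = fun x =>
  \1_(`[- (n.+1%:R / 2), n.+1%:R / 2]) x * @bspline R n.+1 x); last first.
  apply/funext => x; rewrite indicE mem_setE/= in_itv/=.
  rewrite -ler_norml; case: leP => [_|/bspline_supp ->]; last by rewrite mulr0.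
  by rewrite mul1r.
apply: (integrable_mul_bounded _ _ _ _ _ 1).
- exact: integrable_indic_itv.
- exact: measurable_bspline.
- exact: bspline_norm.
Qed.

Lemma bspline2E x : @bspline R 2 x = Num.max 0 (1 - `|x|).
Proof.
rewrite bsplineSS bspline1 /convolution.
(* A product of two boxes is the indicator of their overlap, so the convolution is the length of
   that overlap; an empty overlap accounts for the maximum with 0. *)
rewrite (_ : (fun y => _) = (\1_(`[Num.max (- 2^-1) (x - 2^-1),
    Num.min 2^-1 (x + 2^-1)]) : R -> R)); last first.
  apply/funext => y; rewrite indicE mem_setE/= in_itv/= !boxE.
  rewrite (_ : (- 2^-1 <= x - y <= 2^-1) = (x - 2^-1 <= y) && (y <= x + 2^-1)).
    rewrite ge_max le_min.
    by do 4 case: (_ <= _); rewrite /= ?mulr1 ?mulr0.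
  by apply/idP/idP => /andP[? ?]; apply/andP; split; lra.
rewrite /Rintegral integral_indic//= setIT lebesgue_measure_itv/= lte_fin.
have [x0|x0] := leP 0 x.
  rewrite max_r ?min_l; [|lra|lra].
  by rewrite ger0_norm// maxEle; case: ltP => ?; case: leP => ?; rewrite /=; lra.
rewrite max_l ?min_r; [|lra|lra].
by rewrite ltr0_norm// maxEle; case: ltP => ?; case: leP => ?; rewrite /=; lra.
Qed.

Lemma maxr_dist u v : `|Num.max 0 u - Num.max 0 v| <= `|u - v| :> R.
Proof.
have := ler_norm (u - v); have := ler_norm (v - u); rewrite (distrC v).
move: `|u - v| => d ? ?; rewrite ler_norml !maxEle.
by case: (leP 0 u) => ?; case: (leP 0 v) => ?; lra.
Qed.

(** The hat function is the first 1-Lipschitz B-spline, the box being discontinuous; averaging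
    against the box preserves the constant 1. *)
Lemma bspline_lipschitz n x y : `|@bspline R n.+2 x - @bspline R n.+2 y| <= `|x - y|.
Proof.
elim: n x y => [|n IH] x y.
  rewrite !bspline2E (le_trans (maxr_dist _ _))//.
  rewrite (_ : _ - _ = `|y| - `|x|); last by ring.
  by rewrite (distrC x) ler_dist_dist.
rewrite bsplineSS /convolution -RintegralB//; last 2 first.
- apply: (integrable_box_shift _ _ 1); [exact: measurable_bspline|exact: bspline_norm].
- apply: (integrable_box_shift _ _ 1); [exact: measurable_bspline|exact: bspline_norm].
have ib (z : R) : mu.-integrable setT (EFin \o (fun y => box y * @bspline R n.+2 (z - y))).
  by apply: (integrable_box_shift _ _ 1); [exact: measurable_bspline|exact: bspline_norm].
have iB := integrable_Rsub _ _ (ib x) (ib y).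
apply: le_trans; first exact: le_normr_Rintegral.
rewrite -[leRHS]mul1r -Rintegral_box -RintegralZr//; last exact: integrable_box.
apply: le_Rintegral => //.
- exact: integrable_norm.
- apply: (integrable_mul_bounded _ _ _ _ _ `|x - y|) => //; first exact: integrable_box.
  by move=> ?; rewrite normr_id.
- move=> t _; rewrite -mulrBr normrM (ger0_norm (box_ge0 t)) ler_wpM2l ?box_ge0//.
  by apply: le_trans; first exact: IH; rewrite (_ : x - t - (y - t) = x - y)//; ring.
Qed.

End bspline_theory.

(** * Fourier transform of the B-splines *)

Section fourier_transform.
Context {R : realType}.
Notation mu := (@lebesgue_measure R).
Implicit Types (f g h : R -> R).

Lemma sincN (x : R) : sinc (- x) = sinc x.
Proof.
by rewrite /sinc oppr_eq0 mulrN sinN invrN mulrNN.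
Qed.

Lemma Rintegral_box_cos (p q : R) :
  \int[mu]_z (box z * cos (2 * pi * p * z + q)) = sinc p * cos q.
Proof.
transitivity (\int[mu]_(z in `[- 2^-1, 2^-1]) cos (2 * pi * p * z + q)).
  rewrite [RHS]Rintegral_mkcond; apply: eq_Rintegral => z _.
  rewrite patchE boxE mem_setE/= in_itv/=.
  by case: ifPn; rewrite ?mul1r ?mul0r.
rewrite /sinc; have [->|p0] := eqVneq p 0.
  under eq_Rintegral do rewrite mulr0 mul0r add0r.
  rewrite Rintegral_cst// /= lebesgue_measure_itv/= lte_fin ifT; last by lra.
  by rewrite -EFinD/= mul1r; lra.
have pi0 : (pi : R) != 0 by rewrite gt_eqF// pi_gt0.
pose F (z : R) := sin (2 * pi * p * z + q) / (2 * pi * p).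
have dF (z : R) : is_derive z 1 F (cos (2 * pi * p * z + q)).
  have c0 : 2 * pi * p != 0 :> R by rewrite !mulf_neq0.
  have dL : is_derive z 1 ((2 * pi * p) \*: (id : R -> R) + cst q) ((2 * pi * p) *: 1 + 0).
    exact: is_deriveD.
  have dS := is_derive1_comp (is_derive_sin _) dL.
  have := is_deriveZ (2 * pi * p)^-1 dS.
  rewrite (_ : _ \*: _ = F); last first.
    by apply/funext => y; rewrite /F [RHS]mulrC.
  move=> h; apply: is_derive_eq h _.
  by rewrite addr0 /GRing.scale/= mulr1 mulrCA mulVf// mulr1.
rewrite /Rintegral (@continuous_FTC2 _ _ F); last 4 first.
- lra.
- apply: continuous_subspaceT => z.
  apply: continuous_comp; last exact: continuous_cos.
  by apply: cvgD; [apply: cvgM; [exact: cvg_cst|exact: cvg_id]|exact: cvg_cst].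
- split.
  + by move=> z _; exact: ex_derive.
  + by apply: cvg_at_right_filter;
      apply/differentiable_continuous/derivable1_diffP; exact: ex_derive.
  + by apply: cvg_at_left_filter;
      apply/differentiable_continuous/derivable1_diffP; exact: ex_derive.
- by move=> z _; rewrite derive1E; exact: derive_val.
rewrite -EFinB/= /F !mulrN !sinD sinN cosN.
have -> : 2 * pi * p / 2 = pi * p by field.
clear dF F; move: (pi : R) pi0 => w w0.
by field; rewrite p0 w0.
Qed.

(* The arbitrary phase q makes the induction work: convolving with the box shifts the phase. *)
Lemma Rintegral_bspline_cos n (p q : R) :
  \int[mu]_y (@bspline R n.+1 y * cos (2 * pi * p * y + q)) = sinc p ^+ n.+1 * cos q.
Proof.
elim: n q => [|n IH] q; first exact: Rintegral_box_cos.
set g := @bspline R n.+1.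
have mg : measurable_fun setT g by exact: measurable_bspline.
pose f (w : R * R) := box w.2 * g (w.1 - w.2) * cos (2 * pi * p * w.1 + q).
have mf : measurable_fun setT f.
  apply: measurable_funM; first exact: measurable_box_shift.
  exact: (measurableT_comp (measurable_cos_affine _ _)).
(* [A] is the half-width of the support of [bspline n.+2]. The integrand [f] is bounded by 1 and
   vanishes off the square of half-width [A], so Fubini applies. *)
pose A : R := n.+2%:R / 2.
have fi : (mu \x mu)%E.-integrable setT (EFin \o f).
  pose B := `[- A, A]%classic `*` `[- A, A]%classic.
  have mB : measurable B by exact: measurableX.
  rewrite (_ : f = fun w => \1_B w * f w); last first.
    apply/funext => -[y z]; rewrite indicE; have [|] := boolP ((y, z) \in B).
      by rewrite mul1r.
    rewrite mul0r /B notin_setE /= !in_itv/= -!ler_norml => yzB.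
    rewrite /f /=.
    have [zA|zA] := ltP 2^-1 `|z|.
      by rewrite boxE -ler_norml leNgt zA/= !mul0r.
    rewrite /g bspline_supp ?mulr0 ?mul0r//.
    rewrite ltNge; apply/negP => yz; apply: yzB.
    rewrite /A -[n.+2]addn1 natrD mulrDl; split.
      rewrite -(subrK z y); apply: le_trans (ler_normD _ _) _.
      by apply: lerD => //; lra.
    apply: le_trans zA _; rewrite mul1r lerDr divr_ge0//.
  apply: (integrable_mul_bounded _ _ _ _ _ 1) => //.
    apply/integrableP; split; first exact/measurable_EFinP/measurable_indic.
    under eq_integral do rewrite /= ger0_norm//.
    rewrite integral_indic// setIT.
    rewrite [X in (X < _)%E](product_measure1E mu mu)//= !lebesgue_measure_itv/=.
    by case: ifP; rewrite ?mul0e ?ltry// -!EFinD -EFinM ltry.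
  move=> w; rewrite /f !normrM -[leRHS]mulr1 ler_pM ?mulr_ge0// ?cos_max//.
  by rewrite -[leRHS]mulr1 ler_pM// ?bspline_norm// ger0_norm ?box_ge0 ?box_le1.
have bz (y : R) : mu.-integrable setT (EFin \o (fun z => box z * g (y - z))).
  by apply: (integrable_box_shift _ _ 1) => //; exact: bspline_norm.
transitivity (fine (\int[mu]_y \int[mu]_z (f (y, z))%:E)%E).
  congr fine; apply: eq_integral => y _.
  rewrite bsplineSS /convolution -/g -RintegralZr// /Rintegral fineK//.
  apply: integrable_fin_num => //.
  apply: (integrable_mul_bounded _ _ _ _ _ 1) => //.
  by move=> _; exact: cos_max.
rewrite (Fubini fi).
rewrite exprS mulrAC -Rintegral_box_cos.
rewrite -RintegralZr//; last first.
  apply: (integrable_mul_bounded _ _ _ _ _ 1); first exact: integrable_box.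
    exact: measurable_cos_affine.
  by move=> z; exact: cos_max.
congr fine; apply: eq_integral => z _.
have gc : mu.-integrable setT (EFin \o (fun y => g (- z + 1 * y) * cos (2 * pi * p * y + q))).
  apply: (integrable_mul_bounded _ _ _ _ _ 1).
  - by apply: integrable_affine => //; exact: integrable_bspline.
  - exact: measurable_cos_affine.
  - by move=> y; exact: cos_max.
have E y : f (y, z) = box z * (g (- z + 1 * y) * cos (2 * pi * p * y + q)).
  by rewrite /f/= mulrA mul1r (addrC (- z)).
under eq_integral do rewrite /= E.
transitivity (box z * \int[mu]_y (g (- z + 1 * y) * cos (2 * pi * p * y + q)))%:E.
  rewrite -RintegralZl// /Rintegral fineK//.
  apply: integrable_fin_num => //.
  exact: integrable_Rscale.
congr EFin; rewrite -[RHS]mulrA; congr (_ * _).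
(* The induction hypothesis is used at phase [2 * pi * p * z + q], the one produced by translating
   [y] by [z]; the outer integral over [z] is then the box case. *)
rewrite [RHS]mulrC -IH.
rewrite [RHS](Rintegral_affine (- z) 1)//; last first.
  by apply: measurable_funM => //; exact: measurable_cos_affine.
rewrite mul1r; apply: eq_Rintegral => y _; congr (_ * cos _); ring.
Qed.

End fourier_transform.

(** * Sums over the integers from -m to m *)

Definition symsum {V : nmodType} (m : nat) (f : int -> V) : V :=
  \sum_(i < (2 * m).+1) f (i%:Z - m%:Z).

Section symsum_theory.
Context {V : nmodType}.

Lemma symsum0 (f : int -> V) : symsum 0 f = f 0.
Proof. by rewrite /symsum big_ord1. Qed.

Lemma symsumS m (f : int -> V) :
  symsum m.+1 f = symsum m f + (f m.+1%:Z + f (- m.+1%:Z)).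
Proof.
rewrite /symsum (_ : (2 * m.+1).+1 = (2 * m).+3); last by lia.
rewrite big_ord_recr big_ord_recl /= (addrC (f _)) -addrA (addrC (f _)).
congr (_ + (f _ + f _)); [|by lia|by lia].
by apply: eq_bigr => i _; congr f; rewrite /bump/=; lia.
Qed.

Lemma eq_symsum m (f g : int -> V) : f =1 g -> symsum m f = symsum m g.
Proof. by move=> fg; apply: eq_bigr => i _. Qed.

Lemma symsumD m (f g : int -> V) :
  symsum m (fun k => f k + g k) = symsum m f + symsum m g.
Proof. exact: big_split. Qed.

End symsum_theory.

Lemma symsumZ {R : pzRingType} m (c : R) (f : int -> R) :
  symsum m (fun k => c * f k) = c * symsum m f.
Proof. by rewrite /symsum mulr_sumr. Qed.

Section integral_symsum.
Context {R : realType}.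
Notation mu := (@lebesgue_measure R).

Lemma Rintegral_symsum m (F : int -> R -> R) :
  (forall k, mu.-integrable setT (EFin \o F k)) ->
  \int[mu]_x symsum m (F ^~ x) = symsum m (fun k => \int[mu]_x F k x).
Proof. by move=> Fi; rewrite Rintegral_sum. Qed.

Lemma integrable_symsum m (F : int -> R -> R) :
  (forall k, mu.-integrable setT (EFin \o F k)) ->
  mu.-integrable setT (EFin \o (fun x => symsum m (F ^~ x))).
Proof. by move=> Fi; exact: integrable_Rsum. Qed.

End integral_symsum.


(** * Trigonometric identities and inequalities *)

Section trigonometry.
Context {R : realType}.

Lemma cosD2pi_int (x : R) (z : int) : cos (x + 2 * pi * z%:~R) = cos x.
Proof.
have H (n : nat) (y : R) : cos (y + 2 * pi * n%:R) = cos y.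
  rewrite -[RHS](periodicn (@cosD2pi R) n); congr (cos (_ + _)).
  by rewrite -mulr_natr mulr2n; ring.
case: z => n; first exact: H.
rewrite NegzE mulrNz mulrN -(H n.+1) subrK; congr cos.
Qed.

Lemma sin_pi_int (z : int) : sin (pi * z%:~R) = 0 :> R.
Proof.
have H (n : nat) : sin (pi * n%:R) = 0 :> R.
  elim: n => [|n IH]; first by rewrite mulr0 sin0.
  by rewrite -addn1 natrD mulrDr mulr1 sinD IH sinpi mul0r mulr0 addr0.
case: z => n; first exact: H.
by rewrite NegzE mulrNz mulrN sinN; apply/eqP; rewrite oppr_eq0 H.
Qed.

Lemma sinc_int (z : int) : sinc (z%:~R : R) = (z == 0)%:R.
Proof. by rewrite /sinc intr_eq0; case: ifP => // _; rewrite sin_pi_int mul0r. Qed.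

Lemma cos_lipschitz (x y : R) : `|cos x - cos y| <= `|x - y|.
Proof.
wlog xy : x y / y <= x.
  move=> H; have [|/ltW] := leP y x; first exact: H.
  by move=> /H; rewrite distrC (distrC x).
have [//|c _ ->] := @MVT_segment R cos (fun z => - sin z) y x xy.
- by apply: continuous_subspaceT => z; exact: continuous_cos.
- by rewrite normrM normrN ler_piMl// sin_max.
Qed.

(** By the mean value theorem [sin w = w * cos c] with [c] between 0 and [w], and cosine decreases
    there. *)
Lemma sin_ge_cos (w : R) : 0 <= w <= pi / 2 -> w * cos w <= sin w.
Proof.
move=> /andP[w0 wpi].
have [|c] := @MVT_segment R sin cos 0 w w0 (fun z _ => is_derive_sin z).
  by apply: continuous_subspaceT => z; exact: continuous_sin.
rewrite in_itv/= sin0 !subr0 => /andP[c0 cw] ->; rewrite mulrC ler_wpM2r//.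
have pi0 := pi_gt0 R.
have [->//|cw'] := eqVneq c w.
by apply/ltW; rewrite ltr_cos ?in_itv/= ?lt_neqAle ?cw' ?cw//; apply/andP; split => //; lra.
Qed.

(* From sin w >= w cos w at w = v / 2 and 2 cos^2 (v / 2) = 1 + cos v >= 1. *)
Lemma sin_ge_half (v : R) : 0 <= v <= pi / 2 -> v / 2 <= sin v.
Proof.
move=> /andP[v0 vpi]; have pi0 := pi_gt0 R.
have vE : v = v / 2 + v / 2 by lra.
have s := @sin_ge_cos (v / 2).
have {}s : v / 2 * cos (v / 2) <= sin (v / 2) by apply: s; apply/andP; split; lra.
have c0 : 0 <= cos (v / 2) by apply: cos_ge0_pihalf; apply/andP; split; lra.
have cv : 0 <= cos v by apply: cos_ge0_pihalf; apply/andP; split; lra.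
have := cosD (v / 2) (v / 2); have := sinD (v / 2) (v / 2); rewrite -vE => -> cE.
have c2 : 1 <= 2 * (cos (v / 2) * cos (v / 2)).
  have := cos2Dsin2 (v / 2); rewrite !expr2; lra.
have : v / 2 * cos (v / 2) * cos (v / 2) <= sin (v / 2) * cos (v / 2) by exact: ler_wpM2r.
have : v / 2 * 1 <= v / 2 * (2 * (cos (v / 2) * cos (v / 2))).
  by apply: ler_wpM2l => //; lra.
lra.
Qed.

(** On the half period [|u|] is at most [|sin (pi * u)|]; if [|u|] exceeds [e], then
    [|u| <= u ^+ 2 / e]. This trades the distance to 0 for the quantity that the Fejer kernel
    controls. *)
Lemma abs_le_sin (u e : R) : 0 < e -> `|u| <= 2^-1 -> `|u| <= e + sin (pi * u) ^+ 2 / e.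
Proof.
move=> e0 u2; have pi0 := pi_gt0 R; have pi2 := pi_ge2 R.
have us : `|u| ^+ 2 <= sin (pi * u) ^+ 2.
  have H : `|u| <= sin (pi * `|u|).
    apply: (@le_trans _ _ (pi * `|u| / 2)).
      by rewrite mulrAC ler_peMl//; lra.
    apply: sin_ge_half; rewrite mulr_ge0 ?(ltW pi0)//=.
    by rewrite ler_pM2l.
  suff -> : sin (pi * u) ^+ 2 = sin (pi * `|u|) ^+ 2.
    by rewrite ler_pXn2r// nnegrE// (le_trans _ H).
  by case: (ger0P u) => // _; rewrite mulrN sinN sqrrN.
have [ue|eu] := leP `|u| e.
  by apply: (le_trans ue); rewrite lerDl divr_ge0// ?sqr_ge0// ltW.
rewrite -[leLHS]add0r lerD ?(ltW e0)// ler_pdivlMr//.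
by apply: le_trans us; rewrite expr2 ler_wpM2l// ltW.
Qed.

End trigonometry.

(** * Dirichlet and Fejer kernels *)

Section fejer_kernel.
Context {R : realType}.
Notation mu := (@lebesgue_measure R).

Definition dirichlet (m : nat) (u : R) : R :=
  symsum m (fun r => cos (2 * pi * r%:~R * u)).

(** Unnormalised: the usual factor 1/n is left out, so the mass over a period is n. *)
Definition fejer (n : nat) (u : R) : R := \sum_(m < n) dirichlet m u.

Lemma dirichletS m u :
  dirichlet m.+1 u = dirichlet m u + 2 * cos (2 * pi * m.+1%:R * u).
Proof.
rewrite /dirichlet symsumS; congr (_ + _).
by rewrite mulrNz mulrN mulNr cosN [RHS]mulr_natl mulr2n.
Qed.

(** Multiplied by the sine, each new cosine becomes a difference of two sines and the sum
    telescopes. The product form remains valid at integers. *)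
Lemma dirichlet_sin m u : sin (pi * u) * dirichlet m u = sin ((2 * m + 1)%:R * (pi * u)).
Proof.
elim: m => [|m IH].
  by rewrite /dirichlet symsum0 mulr0 mul0r cos0 mulr1 mul1r.
rewrite dirichletS mulrDr IH.
have -> : (2 * m.+1 + 1)%:R * (pi * u) = 2 * pi * m.+1%:R * u + pi * u :> R.
  by rewrite natrD natrM; ring.
have -> : (2 * m + 1)%:R * (pi * u) = 2 * pi * m.+1%:R * u - pi * u :> R.
  by rewrite natrD natrM -natr1; ring.
rewrite sinB sinD; ring.
Qed.

(** Telescoping again: by [dirichlet_sin] the increment is [sin (A - B) * sin (A + B)], which equals
    [sin A ^+ 2 - sin B ^+ 2]. *)
Lemma fejer_sin n u : fejer n u * sin (pi * u) ^+ 2 = sin (n%:R * (pi * u)) ^+ 2.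
Proof.
elim: n => [|n IH]; first by rewrite /fejer big_ord0 !mul0r sin0 expr0n.
rewrite /fejer big_ord_recr/= -/(fejer n u) mulrDl IH.
set B := n%:R * (pi * u); set A := n.+1%:R * (pi * u).
have -> : dirichlet n u * sin (pi * u) ^+ 2 = sin (A - B) * sin (A + B).
  have -> : A - B = pi * u by rewrite /A /B -natr1; ring.
  have -> : A + B = (2 * n + 1)%:R * (pi * u) by rewrite /A /B natrD natrM -natr1; ring.
  by rewrite -dirichlet_sin; ring.
rewrite sinB sinD; move: A B => A B.
have -> : (sin A * cos B - cos A * sin B) * (sin A * cos B + cos A * sin B)
  = sin A ^+ 2 * cos B ^+ 2 - cos A ^+ 2 * sin B ^+ 2 by ring.
by rewrite !cos2sin2; ring.
Qed.

Lemma fejer_ge0 n u : 0 <= fejer n u.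
Proof.
have [s0|s0] := eqVneq (sin (pi * u)) 0; last first.
  by rewrite -(pmulr_lge0 _ (_ : 0 < sin (pi * u) ^+ 2)) ?fejer_sin ?sqr_ge0// exprn_even_gt0.
(* Where [sin (pi * u)] vanishes, [fejer_sin] gives no information. There every [sin (j * pi * u)]
   vanishes too, so each cosine in the Dirichlet sum is a square. *)
apply: sumr_ge0 => m _; elim: (m : nat) => [|k IH].
  by rewrite /dirichlet symsum0 mulr0 mul0r cos0.
rewrite dirichletS addr_ge0// mulr_ge0//.
have sk (j : nat) : sin (j%:R * (pi * u)) = 0.
  elim: j => [|j IHj]; first by rewrite mul0r sin0.
  by rewrite -natr1 mulrDl mul1r sinD s0 IHj mul0r mulr0 addr0.
have -> : 2 * pi * k.+1%:R * u = k.+1%:R * (pi * u) + k.+1%:R * (pi * u) by ring.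
by rewrite cosD !sk mul0r subr0 -expr2 sqr_ge0.
Qed.

Lemma fejer_sin_le1 n u : fejer n u * sin (pi * u) ^+ 2 <= 1.
Proof.
rewrite fejer_sin -real_normK ?num_real// expr_le1//; exact: sin_max.
Qed.

Lemma fejerD_int n u (k : int) : fejer n (u + k%:~R) = fejer n u.
Proof.
apply: eq_bigr => m _; apply: eq_symsum => r.
by rewrite mulrDr -mulrA -[2 * pi * r%:~R * k%:~R]mulrA -intrM cosD2pi_int mulrA.
Qed.

Lemma dirichlet_max m u : `|dirichlet m u| <= (2 * m).+1%:R.
Proof.
apply: le_trans (ler_norm_sum _ _ _) _.
apply: le_trans (ler_sum _ (fun i _ => cos_max _)) _.
by rewrite sumr_const card_ord.
Qed.

Lemma fejer_max n u : `|fejer n u| <= \sum_(m < n) (2 * m).+1%:R.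
Proof.
by apply: le_trans (ler_norm_sum _ _ _) _; apply: ler_sum => m _; exact: dirichlet_max.
Qed.

Lemma measurable_fejer n : measurable_fun setT (fejer n).
Proof.
apply: measurable_sum => m; apply: measurable_sum => i.
under eq_fun do rewrite -[X in cos X]addr0.
exact: measurable_cos_affine.
Qed.

(** Frequency r contributes [sinc r], which is 0 except at r = 0, so each Dirichlet kernel has mass
    1. *)
Lemma Rintegral_box_fejer n : \int[mu]_u (box u * fejer n u) = n%:R.
Proof.
have ib (p : R) : mu.-integrable setT (EFin \o (fun u => box u * cos (2 * pi * p * u))).
  apply: (integrable_mul_bounded _ _ _ _ _ 1); first exact: integrable_box.
    under eq_fun do rewrite -[X in cos X]addr0.
    exact: measurable_cos_affine.
  by move=> u; exact: cos_max.
under eq_Rintegral do rewrite mulr_sumr.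
have E m u : box u * dirichlet m u =
    \sum_(i < (2 * m).+1) (box u * cos (2 * pi * (i%:Z - m%:Z)%:~R * u)).
  by rewrite mulr_sumr.
rewrite Rintegral_sum; last first.
  by move=> m; under eq_fun do rewrite E; exact: integrable_Rsum.
transitivity (\sum_(m < n) (1 : R)); last by rewrite sumr_const card_ord.
apply: eq_bigr => m _; under eq_Rintegral do rewrite E.
rewrite Rintegral_sum//.
have D k : symsum k (fun r => \int[mu]_u (box u * cos (2 * pi * r%:~R * u))) = 1.
  have S (r : int) : \int[mu]_u (box u * cos (2 * pi * r%:~R * u)) = (r == 0)%:R.
    under eq_Rintegral do rewrite -[X in cos X]addr0.
    by rewrite Rintegral_box_cos cos0 mulr1 sinc_int.
  by elim: k => [|k IH]; rewrite ?symsum0 ?symsumS ?IH !S ?oppr_eq0/= ?addr0.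
exact: D.
Qed.

End fejer_kernel.

(** * The Fejer kernel as an approximate identity, and periodization *)

Section fejer_approximation.
Context {R : realType}.
Notation mu := (@lebesgue_measure R).

(** Replacing [Phi] by the constant [Phi0] costs at most [L * |u|] times the kernel. By [abs_le_sin]
    and [fejer_sin_le1], [|u|] times the kernel is at most [e] times the kernel plus [e^-1];
    integrating over the box gives the bound. The parameter [e] stays free until the division by
    [n]. *)
Lemma fejer_approx n (Phi : R -> R) (Phi0 M L e : R) :
  measurable_fun setT Phi -> (forall u, `|Phi u| <= M) ->
  (forall u, `|u| <= 2^-1 -> `|Phi u - Phi0| <= L * `|u|) -> 0 <= L -> 0 < e ->
  `|\int[mu]_u (box u * (Phi u * fejer n u)) - Phi0 * n%:R| <= L * (e * n%:R + e^-1).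
Proof.
move=> mPhi PhiM PhiL L0 e0.
have ibf (f : R -> R) (C : R) : measurable_fun setT f -> (forall u, `|f u| <= C) ->
    mu.-integrable setT (EFin \o (fun u => box u * (f u * fejer n u))).
  move=> mf fC.
  apply: (integrable_mul_bounded _ _ _ _ _ (C * \sum_(m < n) (2 * m).+1%:R)).
  - exact: integrable_box.
  - by apply: measurable_funM => //; exact: measurable_fejer.
  - by move=> u; rewrite normrM ler_pM// fejer_max.
have iK : mu.-integrable setT (EFin \o (fun u => box u * fejer n u)).
  apply: (integrable_mul_bounded _ _ _ _ _ (\sum_(m < n) (2 * m).+1%:R)).
  - exact: integrable_box.
  - exact: measurable_fejer.
  - by move=> u; rewrite fejer_max.
have i1 := ibf _ _ mPhi PhiM.
have i2 : mu.-integrable setT (EFin \o (fun u => box u * (Phi0 * fejer n u))).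
  by apply: (ibf _ `|Phi0|) => //; exact: measurable_cst.
have -> : Phi0 * n%:R = \int[mu]_u (box u * (Phi0 * fejer n u)).
  rewrite -(Rintegral_box_fejer n) -RintegralZl//.
  by apply: eq_Rintegral => u _; rewrite mulrCA.
rewrite -RintegralB//; apply: le_trans.
  by apply: le_normr_Rintegral => //; exact: integrable_Rsub.
have -> : L * (e * n%:R + e^-1) =
    \int[mu]_u (L * e * (box u * fejer n u) + L * e^-1 * box u).
  rewrite RintegralD//; last 2 first.
  - exact: integrable_Rscale.
  - by apply: integrable_Rscale; exact: integrable_box.
  rewrite !RintegralZl//; last exact: integrable_box.
  by rewrite Rintegral_box_fejer Rintegral_box; ring.
apply: le_Rintegral => //.
- by apply: integrable_norm; exact: integrable_Rsub.
- by apply: integrable_Radd; apply: integrable_Rscale => //; exact: integrable_box.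
move=> u _; rewrite -mulrBr -mulrBl !normrM (ger0_norm (box_ge0 _)) (ger0_norm (fejer_ge0 _ _)).
rewrite boxE -ler_norml; case: ifPn => [u2|_]; last by rewrite !mul0r !mulr0 addr0.
have K0 := fejer_ge0 n u; have Ks := fejer_sin_le1 n u.
rewrite !mul1r mulr1.
apply: le_trans (ler_wpM2r K0 (PhiL _ u2)) _.
rewrite -!mulrA -mulrDr ler_wpM2l//.
apply: le_trans (ler_wpM2r K0 (abs_le_sin _ _ e0 u2)) _.
rewrite mulrDl lerD2l mulrAC -[leRHS]mul1r ler_wpM2r ?invr_ge0 ?(ltW e0)//.
by rewrite mulrC.
Qed.

(* Half-open intervals, unlike the closed support of the box, tile the line exactly. *)
Lemma indic_itvco_split (p q r u : R) : p <= q -> q <= r ->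
  \1_(`[p, r[) u = \1_(`[p, q[) u + \1_(`[q, r[) u :> R.
Proof.
move=> pq qr; rewrite !indicE !mem_setE/= !in_itv/=.
have [uq|qu] := ltP u q; first by rewrite (lt_le_trans uq qr) andbT addr0.
by rewrite (le_trans pq qu) add0r.
Qed.

Lemma indic_itvco_shift (p q c u : R) :
  \1_(`[p, q[) (u - c) = \1_(`[p + c, q + c[) u :> R.
Proof. by rewrite !indicE !mem_setE/= !in_itv/= lerBrDr ltrBlDr. Qed.

Lemma symsum_indic m (u : R) :
  symsum m (fun k => \1_(`[- 2^-1, 2^-1[) (u - k%:~R)) =
  \1_(`[- (m%:R + 2^-1), m%:R + 2^-1[) u :> R.
Proof.
elim: m => [|m IH]; first by rewrite symsum0 subr0 add0r.
rewrite symsumS IH !indic_itvco_shift mulrNz.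
have m0 : 0 <= m%:R :> R by [].
have mE : m.+1%:R = m%:R + 1 :> R by rewrite natr1.
rewrite (_ : m.+1%:Z%:~R = m%:R + 1 :> R)// mE; move: (m%:R : R) m0 => a a0.
rewrite [RHS](indic_itvco_split _ (- (a + 2^-1))); [|lra|lra].
rewrite (indic_itvco_split (- (a + 2^-1)) (a + 2^-1) (a + 1 + 2^-1)); [|lra|lra].
have -> : - 2^-1 + (a + 1) = a + 2^-1 by lra.
have -> : 2^-1 + (a + 1) = a + 1 + 2^-1 by lra.
have -> : - 2^-1 - (a + 1) = - (a + 1 + 2^-1) by lra.
have -> : 2^-1 - (a + 1) = - (a + 2^-1) by lra.
by rewrite [RHS]addrC -[RHS]addrA.
Qed.

Lemma Rintegral_indic_box (f : R -> R) :
  mu.-integrable setT (EFin \o (fun u => box u * f u)) ->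
  \int[mu]_u (\1_(`[- 2^-1, 2^-1[) u * f u) = \int[mu]_u (box u * f u).
Proof.
move=> fi.
have E : \int[mu]_u (box u * f u) = \int[mu]_(u in `[- 2^-1, 2^-1]) f u.
  rewrite [RHS]Rintegral_mkcond; apply: eq_Rintegral => u _.
  by rewrite patchE boxE mem_setE/= in_itv/=; case: ifPn; rewrite ?mul1r ?mul0r.
rewrite E -Rintegral_itv_bndo_bndc.
  rewrite [RHS]Rintegral_mkcond; apply: eq_Rintegral => u _.
  by rewrite patchE indicE; case: ifPn; rewrite ?mul1r ?mul0r.
apply: (@eq_integrable _ _ _ mu _ _ (EFin \o (fun u => box u * f u))) => //.
  move=> u; rewrite inE/= in_itv/= => /andP[u1 u2].
  by rewrite boxE u1 ltW// mul1r.
exact: integrableS fi.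
Qed.

(** The line is cut into unit cells centred at the integers, and each cell is translated back to the
    box. *)
Lemma Rintegral_periodize m (Psi : R -> R) (M : R) :
  measurable_fun setT Psi -> (forall u, `|Psi u| <= M) ->
  (forall u, m%:R + 2^-1 <= `|u| -> Psi u = 0) ->
  \int[mu]_u Psi u = symsum m (fun k => \int[mu]_u (box u * Psi (u + k%:~R))).
Proof.
move=> mPsi PsiM Psi0.
pose hb : R -> R := \1_(`[- 2^-1, 2^-1[).
have mhb : measurable_fun setT hb by exact: measurable_indic.
have mS (c : R) (f : R -> R) : measurable_fun setT f ->
    measurable_fun setT (fun u : R => f (u + c)).
  by move=> mf; apply: (measurableT_comp mf); exact: measurable_funD.
transitivity (\int[mu]_u symsum m (fun k => hb (u - k%:~R) * Psi u)).
  apply: eq_Rintegral => u _.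
  under eq_symsum do rewrite mulrC.
  rewrite symsumZ symsum_indic indicE.
  have [_|] := boolP (u \in _); first by rewrite mulr1.
  (* The half-open window misses its right endpoint [m + 1/2], whence the non-strict inequality in
     the vanishing hypothesis. *)
  rewrite notin_setE/= in_itv/= => /negP h; rewrite Psi0 ?mul0r//; move: h.
  rewrite ler_normr negb_and -ltNge -leNgt => /orP[h|h]; apply/orP; [right|left] => //.
  by rewrite lerNr ltW.
rewrite Rintegral_symsum; last first.
  move=> k; apply: (integrable_mul_bounded _ _ _ _ _ M) => //.
  rewrite (_ : EFin \o _ = EFin \o (fun u => hb (- k%:~R + 1 * u))).
    by apply: integrable_affine => //; exact: integrable_indic_itv.
  by apply/funext => u /=; rewrite mul1r addrC.
apply: eq_symsum => k.
rewrite (Rintegral_affine (k%:~R) 1)//; last first.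
  by apply: measurable_funM => //; exact: mS.
rewrite mul1r -Rintegral_indic_box; last first.
  apply: (integrable_mul_bounded _ _ _ _ _ M) => //; first exact: integrable_box.
  exact: mS.
by apply: eq_Rintegral => u _; rewrite mul1r [_ + u]addrC addrK.
Qed.

End fejer_approximation.

(** * Symmetric sums of reals *)

Section symsum_real.
Context {R : realType}.

Lemma symsum_odd m (f : int -> R) : (forall k, f (- k) = - f k) -> symsum m f = 0.
Proof.
move=> fN; have f0 : f 0 = 0 by have := fN 0; rewrite oppr0; lra.
by elim: m => [|m IH]; rewrite ?symsum0 ?symsumS ?IH ?fN ?f0// subrr addr0.
Qed.

Lemma symsum_norm_le m (f : int -> R) C : (forall k, `|f k| <= C) ->
  `|symsum m f| <= (2 * m).+1%:R * C.
Proof.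
move=> fC; apply: le_trans (ler_norm_sum _ _ _) _.
apply: le_trans (ler_sum _ (fun i _ => fC _)) _.
by rewrite sumr_const card_ord mulr_natl.
Qed.

Lemma symsumB m (f g : int -> R) :
  symsum m (fun k => f k - g k) = symsum m f - symsum m g.
Proof. by rewrite /symsum sumrB. Qed.

End symsum_real.

(** * The inner integral concentrates on the integers *)

Section bspline_sampling.
Context {R : realType}.
Notation mu := (@lebesgue_measure R).
Variables (n : nat) (a : R).
Hypothesis a0 : 0 < a.
Let g : R -> R := @bspline R n.+2.

Lemma integrable_bspline_mul (h : R -> R) (M : R) : measurable_fun setT h ->
  (forall y, `|h y| <= M) -> mu.-integrable setT (EFin \o (fun y => g y * h y)).
Proof.
by move=> mh hM; apply: (integrable_mul_bounded _ _ _ _ _ M) => //; exact: integrable_bspline.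
Qed.

Lemma measurable_bspline_affine (y c : R) : measurable_fun setT (fun u : R => g (y + c * u)).
Proof.
by apply: (measurableT_comp (measurable_bspline _)); exact: measurable_affine.
Qed.

(** The function [G] is bounded by 1 and Lipschitz with constant [a + 2 * pi * |theta|], so
    [fejer_approx] applies on the unit cell around each integer, the kernel being 1-periodic. The
    first factor of the bound counts the cells. *)
Lemma fejer_bspline (m k : nat) (y theta c e : R) :
  n.+2%:R < a * m.+1%:R -> `|y| <= n.+2%:R / 2 -> 0 < e ->
  `|\int[mu]_u (g (y + a * u) * cos (2 * pi * theta * u + c) * fejer k u)
    - symsum m (fun j => g (y + a * j%:~R) * cos (2 * pi * theta * j%:~R + c)) * k%:R|
  <= (2 * m.+1).+1%:R * ((a + 2 * pi * `|theta|) * (e * k%:R + e^-1)).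
Proof.
move=> am yn e0.
pose G (u : R) : R := g (y + a * u) * cos (2 * pi * theta * u + c).
have gz z : n.+2%:R / 2 < `|z| -> g z = 0 by exact: bspline_supp.
(* If both [y] and [y + a * u] lie in the support of [g], then [a * |u|] is at most the support
   width [n.+2], which is below [a * m.+1]. *)
have G0 u : m.+1%:R <= `|u| -> G u = 0.
  move=> mu; rewrite /G gz ?mul0r//.
  have : a * m.+1%:R <= `|a * u| by rewrite normrM gtr0_norm// ler_pM2l.
  have := ler_normB (y + a * u) y; rewrite [y + _]addrC addrK.
  move: `|_| `|_| am yn => A B; lra.
have mG : measurable_fun setT G.
  by apply: measurable_funM; [exact: measurable_bspline_affine|exact: measurable_cos_affine].
have G1 u : `|G u| <= 1.
  by rewrite normrM -[leRHS]mulr1 ler_pM ?bspline_norm ?cos_max.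
(* The cells up to [m] reach only [m + 1/2], while [G] is known to vanish from [m + 1] on. One more
   cell on each side covers the support, and its sample is 0. *)
have -> : symsum m (fun j => g (y + a * j%:~R) * cos (2 * pi * theta * j%:~R + c)) =
    symsum m.+1 (fun j => G j%:~R).
  by rewrite symsumS (G0 m.+1%:~R) ?(G0 (- m.+1%:Z)%:~R) ?addr0// ?mulrNz ?normrN ger0_norm.
rewrite (@Rintegral_periodize _ m.+1 _ (\sum_(m < k) (2 * m).+1%:R)); first last.
- by move=> u mu; rewrite -/(G u) G0 ?mul0r// (le_trans _ mu)// lerDl.
- by move=> u; rewrite -/(G u) normrM -[leRHS]mul1r ler_pM ?fejer_max.
- by apply: measurable_funM => //; exact: measurable_fejer.
rewrite [_ * k%:R]mulrC -symsumZ -symsumB; apply: symsum_norm_le => j.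
have mGj : measurable_fun setT (fun u : R => G (u + j%:~R)).
  by apply: (measurableT_comp mG); exact: measurable_funD.
have L0 : 0 <= a + 2 * pi * `|theta|.
  by rewrite addr_ge0 ?(ltW a0)// !mulr_ge0// pi_ge0.
have GL u : `|u| <= 2^-1 -> `|G (u + j%:~R) - G j%:~R| <= (a + 2 * pi * `|theta|) * `|u|.
  move=> _; rewrite /G.
  set g1 := g _; set c1 := cos _; set g2 := g _; set c2 := cos _.
  have -> : g1 * c1 - g2 * c2 = (g1 - g2) * c1 + g2 * (c1 - c2) by ring.
  apply: le_trans (ler_normD _ _) _; rewrite !normrM mulrDl lerD//.
    rewrite -[leRHS]mulr1 ler_pM// ?cos_max//.
    apply: le_trans (bspline_lipschitz _ _ _) _.
    rewrite (_ : _ - _ = a * u); last by ring.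
    by rewrite normrM gtr0_norm.
  rewrite -[leRHS]mul1r ler_pM// ?bspline_norm//.
  apply: le_trans (cos_lipschitz _ _) _.
  rewrite (_ : _ - _ = 2 * pi * theta * u); last by ring.
  by rewrite !normrM (ger0_norm (pi_ge0 R)) ger0_norm.
have := fejer_approx k _ _ _ _ _ mGj (fun u => G1 _) GL L0 e0.
rewrite [k%:R * _]mulrC; congr (`|_ - _| <= _).
by apply: eq_Rintegral => u _; rewrite fejerD_int.
Qed.

End bspline_sampling.

(** * The sinc series as a Fejer integral *)

Section spectral_side.
Context {R : realType}.
Notation mu := (@lebesgue_measure R).
Variables (n : nat) (a b x : R) (l : int).
Hypothesis a0 : 0 < a.
Let g : R -> R := @bspline R n.+2.
Let theta : R := x + a * b * l%:~R / 2.

Let F (r : int) : R :=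
  sinc ((r%:~R - (x - a * b * l%:~R / 2)) / a) ^+ n.+2
  * sinc ((r%:~R - (x + a * b * l%:~R / 2)) / a) ^+ n.+2.

(** The sine half of the expansion of [cos (A - B)] is odd in [r] and cancels in the symmetric
    sum. *)
Lemma symsum_cos_fejer (A u : R) k :
  \sum_(m < k) symsum m (fun r => cos (A - 2 * pi * r%:~R * u)) = cos A * fejer k u.
Proof.
rewrite /fejer mulr_sumr; apply: eq_bigr => m _; rewrite /dirichlet -symsumZ.
under eq_symsum do rewrite cosB.
rewrite symsumD [X in _ + X]symsum_odd ?addr0// => r.
by rewrite mulrNz mulrN mulNr sinN mulrN.
Qed.

(** One of the two sinc powers is kept; the other is replaced by the cosine whose integral against
    [g] produces it. *)
Definition spectral (k : nat) (y : R) : R := \sum_(m < k) symsum m (fun r =>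
  a^-1 * sinc ((r%:~R - theta) / a) ^+ n.+2
  * cos (2 * pi * ((r%:~R - (x - a * b * l%:~R / 2)) / a) * y)).

Lemma spectral_fejer k y : spectral k y =
  \int[mu]_u (g (y + a * u) * cos (2 * pi * theta * u + 2 * pi * b * l%:~R * y) * fejer k u).
Proof.
have a1 : a != 0 by rewrite gt_eqF.
pose c (r : int) (u : R) := cos (2 * pi * (theta - r%:~R) * u + 2 * pi * b * l%:~R * y).
have gc r : mu.-integrable setT (EFin \o (fun u => g (y + a * u) * c r u)).
  apply: (integrable_mul_bounded _ _ _ _ _ 1).
  - by apply: integrable_affine => //; exact: integrable_bspline.
  - exact: measurable_cos_affine.
  - by move=> u; exact: cos_max.
transitivity (\int[mu]_u \sum_(m < k) symsum m (fun r => g (y + a * u) * c r u)); last first.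
  apply: eq_Rintegral => u _; rewrite -mulrA -symsum_cos_fejer mulr_sumr.
  apply: eq_bigr => m _; rewrite -symsumZ; apply: eq_symsum => r.
  by congr (_ * cos _); ring.
rewrite Rintegral_sum; last first.
  by move=> m; exact: (integrable_symsum m (fun r u => g (y + a * u) * c r u)).
apply: eq_bigr => m _.
rewrite (Rintegral_symsum m (fun r u => g (y + a * u) * c r u))//.
apply: eq_symsum => r.
(* The remaining sinc power is in turn the Fourier integral of [g] at frequency [eta]. The cosine
   has frequency [b * l - eta], so substituting [y + a * u] cancels the terms [eta * y] in the
   phase. *)
pose eta := (theta - r%:~R) / a.
have -> : (r%:~R - theta) / a = - eta by rewrite /eta -mulNr opprB.
rewrite sincN -mulrA; apply: (mulfI a1); rewrite mulVKf//.
have -> : cos (2 * pi * ((r%:~R - (x - a * b * l%:~R / 2)) / a) * y) =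
    cos (2 * pi * b * l%:~R * y - 2 * pi * eta * y).
  by congr cos; rewrite /eta /theta; field.
rewrite -Rintegral_bspline_cos (Rintegral_affine y a)//; last first.
  apply: measurable_funM; [exact: measurable_bspline|exact: measurable_cos_affine].
congr (_ * _); apply: eq_Rintegral => u _; congr (_ * cos _).
by rewrite /eta; field.
Qed.

Lemma integrable_spectral_term r : mu.-integrable setT (EFin \o (fun y => g y *
  (a^-1 * sinc ((r%:~R - theta) / a) ^+ n.+2
   * cos (2 * pi * ((r%:~R - (x - a * b * l%:~R / 2)) / a) * y)))).
Proof.
apply: (integrable_bspline_mul _ _ `|a^-1 * sinc ((r%:~R - theta) / a) ^+ n.+2|).
  apply: measurable_funM => //.
  under eq_fun do rewrite -[X in cos X]addr0.
  exact: measurable_cos_affine.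
by move=> y; rewrite normrM ler_piMr// cos_max.
Qed.

Lemma bspline_spectralE k y : g y * spectral k y = \sum_(m < k) symsum m (fun r => g y *
  (a^-1 * sinc ((r%:~R - theta) / a) ^+ n.+2
   * cos (2 * pi * ((r%:~R - (x - a * b * l%:~R / 2)) / a) * y))).
Proof. by rewrite mulr_sumr; apply: eq_bigr => m _; rewrite symsumZ. Qed.

Lemma integrable_bspline_spectral k :
  mu.-integrable setT (EFin \o (fun y => g y * spectral k y)).
Proof.
under eq_fun do rewrite bspline_spectralE.
apply: integrable_Rsum => m.
apply: (integrable_symsum m (fun r y => g y * (a^-1 * sinc ((r%:~R - theta) / a) ^+ n.+2
   * cos (2 * pi * ((r%:~R - (x - a * b * l%:~R / 2)) / a) * y)))).
exact: integrable_spectral_term.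
Qed.

Lemma Rintegral_bspline_spectral k :
  \int[mu]_y (g y * spectral k y) = a^-1 * \sum_(m < k) symsum m F.
Proof.
under eq_Rintegral do rewrite bspline_spectralE.
pose h r y := g y * (a^-1 * sinc ((r%:~R - theta) / a) ^+ n.+2
   * cos (2 * pi * ((r%:~R - (x - a * b * l%:~R / 2)) / a) * y)).
have ih r : mu.-integrable setT (EFin \o h r) by exact: integrable_spectral_term.
rewrite Rintegral_sum; last by move=> m; exact: (integrable_symsum m h).
rewrite mulr_sumr; apply: eq_bigr => m _.
rewrite (Rintegral_symsum m h)// -symsumZ; apply: eq_symsum => r.
rewrite /h; under eq_Rintegral do rewrite mulrCA -[X in cos X]addr0.
rewrite RintegralZl//; last first.
  apply: integrable_bspline_mul; first exact: measurable_cos_affine.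
  by move=> y; exact: cos_max.
by rewrite Rintegral_bspline_cos cos0 mulr1 -[LHS]mulrA [X in _ * X = _]mulrC.
Qed.

End spectral_side.

(** * The trigonometric polynomial as an integral of samples *)

Section time_side.
Context {R : realType}.
Notation mu := (@lebesgue_measure R).
Variables (n : nat) (a b x : R) (l : int).
Hypothesis a0 : 0 < a.
Let g : R -> R := @bspline R n.+2.
Let theta : R := x + a * b * l%:~R / 2.
Let K := Num.truncn (n.+2%:R / a).

Lemma integrable_bspline_pair (h : R -> R) (c : R) : measurable_fun setT h ->
  (forall y, `|h y| <= 1) ->
  mu.-integrable setT (EFin \o (fun y => g (y - c) * g (y + c) * h y)).
Proof.
move=> mh h1.
rewrite (_ : EFin \o _ = EFin \o (fun y => g (- c + 1 * y) * (g (c + 1 * y) * h y))).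
  apply: (integrable_mul_bounded _ _ _ _ _ 1).
  - by apply: integrable_affine => //; exact: integrable_bspline.
  - by apply: measurable_funM => //; exact: measurable_bspline_affine.
  - by move=> y; rewrite normrM -[leRHS]mulr1 ler_pM// bspline_norm.
by apply/funext => y /=; rewrite mulrA !mul1r (addrC y) (addrC y).
Qed.

Lemma measurable_sin_affine (p q : R) :
  measurable_fun setT (fun y : R => sin (p * y + q)).
Proof.
under eq_fun do rewrite -cosBpihalf -addrA.
exact: measurable_cos_affine.
Qed.

(** For [|y| <= n.+2 / 2] this is the limit of [spectral k y / k] as [k] grows, by [spectral_fejer]
    and [fejer_bspline]. *)
Definition sampled (y : R) : R := symsum K (fun k =>
  g (y + a * k%:~R) * cos (2 * pi * theta * k%:~R + 2 * pi * b * l%:~R * y)).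

Lemma integrable_sampled_term k : mu.-integrable setT (EFin \o (fun y => g y *
  (g (y + a * k%:~R) * cos (2 * pi * theta * k%:~R + 2 * pi * b * l%:~R * y)))).
Proof.
apply: (integrable_bspline_mul _ _ 1).
  apply: measurable_funM.
    by apply: (measurableT_comp (measurable_bspline _)); exact: measurable_funD.
  under eq_fun do rewrite addrC.
  exact: measurable_cos_affine.
by move=> y; rewrite normrM -[leRHS]mulr1 ler_pM// ?bspline_norm// cos_max.
Qed.

Lemma integrable_bspline_sampled :
  mu.-integrable setT (EFin \o (fun y => g y * sampled y)).
Proof.
under eq_fun do rewrite /sampled -symsumZ.
apply: (integrable_symsum K (fun k y => g y * (g (y + a * k%:~R) *
  cos (2 * pi * theta * k%:~R + 2 * pi * b * l%:~R * y)))).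
exact: integrable_sampled_term.
Qed.

Lemma t_poly_sampled : t_poly n.+2 a b l x = \int[mu]_y (g y * sampled y).
Proof.
pose w (k : int) (y : R) := g (y - a / 2 * k%:~R) * g (y + a / 2 * k%:~R).
pose U (k : int) := \int[mu]_y (w k y * cos (2 * pi * b * l%:~R * y)).
pose V (k : int) := \int[mu]_y (w k y * sin (2 * pi * b * l%:~R * y)).
have iw k (h : R -> R) : measurable_fun setT h -> (forall y, `|h y| <= 1) ->
    mu.-integrable setT (EFin \o (fun y => w k y * h y)).
  by move=> ? ?; exact: integrable_bspline_pair.
have mc : measurable_fun setT (fun y : R => cos (2 * pi * b * l%:~R * y)).
  by under eq_fun do rewrite -[X in cos X]addr0; exact: measurable_cos_affine.
have ms : measurable_fun setT (fun y : R => sin (2 * pi * b * l%:~R * y)).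
  by under eq_fun do rewrite -[X in sin X]addr0; exact: measurable_sin_affine.
have Veven k : V (- k) = V k.
  by apply: eq_Rintegral => y _; rewrite /w mulrNz mulrN opprK [g _ * _]mulrC.
(* t_coef is even in k, and so is its sine analogue V: cos A cos B may be replaced by
   cos (A + B) in the sum over k. *)
have Vodd : symsum K (fun k => V k * sin (2 * pi * k%:~R * x)) = 0.
  by apply: symsum_odd => k; rewrite Veven mulrNz mulrN mulNr sinN mulrN.
transitivity (symsum K (fun k => U k * cos (2 * pi * k%:~R * x)) -
    symsum K (fun k => V k * sin (2 * pi * k%:~R * x))).
  (* [t_poly] unfolds to the first [symsum]: both enumerate the index as [i - K]. *)
  by rewrite Vodd subr0.
under eq_Rintegral do rewrite /sampled -symsumZ.
rewrite (Rintegral_symsum K (fun k y => g y * (g (y + a * k%:~R) *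
  cos (2 * pi * theta * k%:~R + 2 * pi * b * l%:~R * y)))); last first.
  exact: integrable_sampled_term.
rewrite -symsumB; apply: eq_symsum => k.
rewrite /U /V -RintegralZr//; last by apply: iw => // y; exact: cos_max.
rewrite -RintegralZr//; last by apply: iw => // y; exact: sin_max.
rewrite -RintegralB//; last 2 first.
- apply: (integrable_mul_bounded _ _ _ _ _ `|cos (2 * pi * k%:~R * x)|) => //.
  by apply: iw => // y; exact: cos_max.
- apply: (integrable_mul_bounded _ _ _ _ _ `|sin (2 * pi * k%:~R * x)|) => //.
  by apply: iw => // y; exact: sin_max.
have mw : measurable_fun setT (w k).
  by apply: measurable_funM; apply: (measurableT_comp (measurable_bspline _));
    exact: measurable_funD.
transitivity (\int[mu]_y (w k y * cos (2 * pi * b * l%:~R * y + 2 * pi * k%:~R * x))).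
  by apply: eq_Rintegral => y _; rewrite cosD mulrBr !mulrA.
(* Translating by [a * k / 2] makes the product [g y * g (y + a * k)] and adds [pi * a * b * l * k]
   to the phase; together with [2 * pi * k * x] this is [2 * pi * theta * k]. *)
rewrite (Rintegral_affine (a / 2 * k%:~R) 1)//; last first.
  by apply: measurable_funM => //; exact: measurable_cos_affine.
rewrite mul1r; apply: eq_Rintegral => y _; rewrite /w -mulrA.
by congr (g _ * (g _ * cos _)); rewrite ?/theta; field.
Qed.

End time_side.

(** * Unordered sums over the integers as limits of symmetric sums *)

Section sums_over_int.
Context {R : realType}.

Let window (m : nat) : seq int := [seq i%:Z - m%:Z | i <- iota 0 (2 * m).+1].

Let mem_window m k : (k \in window m) = (`|k|%N <= m)%N.
Proof.
apply/mapP/idP => [[i]|km]; first by rewrite mem_iota; lia.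
by exists (absz (k + m%:Z)); rewrite ?mem_iota; lia.
Qed.

Lemma fsum_symsum m (f : int -> R) :
  (\sum_(k \in [set` window m]) (f k)%:E)%E = (symsum m f)%:E.
Proof.
rewrite -fsbig_seq; last first.
  by rewrite map_inj_uniq ?iota_uniq// => i j; lia.
by rewrite big_map sumEFin /symsum -(big_mkord xpredT (fun i => f (i%:Z - m%:Z))) /index_iota subn0.
Qed.

Lemma symsum_le_esum m (f : int -> R) :
  ((symsum m f)%:E <= \esum_(k in [set: int]) (f k)%:E)%E.
Proof.
rewrite -fsum_symsum; apply: esum_ge; exists [set` window m] => //.
by split => //; exact: finite_seq.
Qed.

(** Symmetric windows are cofinal among finite sets of integers: it suffices that [m] bounds the
    absolute values in [X]. *)
Lemma fsum_le_symsum (X : set int) (f : int -> R) : finite_set X ->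
  (forall k, 0 <= f k) -> exists M, forall m, (M <= m)%N ->
  (\sum_(k \in X) (f k)%:E <= (symsum m f)%:E)%E.
Proof.
move=> /finite_seqP[s ->] f0; exists (\max_(k <- s) absz k)%N => m Mm.
rewrite -fsum_symsum; apply: lee_fsum_nneg_subset => //; do ?exact: finite_seq.
  apply/subsetP => k /= sk; rewrite mem_window.
  by apply: leq_trans Mm; apply: leq_bigmax_seq.
by move=> k _; rewrite lee_fin.
Qed.

Lemma esum_le_symsum (f : int -> R) (C : R) : (forall k, 0 <= f k) ->
  (forall m, symsum m f <= C) -> (\esum_(k in [set: int]) (f k)%:E <= C%:E)%E.
Proof.
move=> f0 fC; apply: ge_ereal_sup => _ [X [finX _] <-].
have [M /(_ _ (leqnn M)) h] := fsum_le_symsum X f finX f0.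
by apply: le_trans h _; rewrite lee_fin.
Qed.

Lemma cvg_symsum_esum (f : int -> R) : (forall k, 0 <= f k) ->
  (\esum_(k in [set: int]) (f k)%:E < +oo)%E ->
  symsum m f @[m --> \oo] --> fine (\esum_(k in [set: int]) (f k)%:E)%E.
Proof.
move=> f0 fy.
have ff : (\esum_(k in [set: int]) (f k)%:E)%E \is a fin_num.
  by rewrite ge0_fin_numE// esum_ge0// => k _; rewrite lee_fin.
apply/cvgrPdist_le => e e0.
have [_ [X [finX _] <-]] := ub_ereal_sup_adherent e0 ff.
rewrite -/(esum _ _) -(fineK ff) -EFinB; move: (fineK ff).
set L := fine _ => LE hX.
have [M hM] := fsum_le_symsum X f finX f0.
exists M => // m /= Mm.
have := symsum_le_esum m f; have := lt_le_trans hX (hM m Mm).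
by rewrite -LE lee_fin lte_fin ler_norml => ? ?; lra.
Qed.

Lemma cvg_symsum_rsum (f : int -> R) : summable [set: int] (EFin \o f) ->
  symsum m f @[m --> \oo] --> rsum f.
Proof.
move=> sf; pose fp k := Num.max (f k) 0; pose fn k := Num.max (- f k) 0.
have fp0 k : 0 <= fp k by rewrite le_max lexx orbT.
have fn0 k : 0 <= fn k by rewrite le_max lexx orbT.
have fpn k : f k = fp k - fn k by rewrite /fp /fn !maxEle; case: leP => ?; case: leP => ?; lra.
have Ep : ((EFin \o f)^\+ = fun k => (fp k)%:E)%E.
  by apply/funext => k; rewrite funeposE /= EFin_max.
have En : ((EFin \o f)^\- = fun k => (fn k)%:E)%E.
  by apply/funext => k; rewrite funenegE /= EFin_max.
have py : (\esum_(k in [set: int]) (fp k)%:E < +oo)%E.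
  have := summable_funepos sf; rewrite Ep; apply: le_lt_trans.
  by apply: le_esum => k _; rewrite gee0_abs// lee_fin.
have ny : (\esum_(k in [set: int]) (fn k)%:E < +oo)%E.
  have := summable_funeneg sf; rewrite En; apply: le_lt_trans.
  by apply: le_esum => k _; rewrite gee0_abs// lee_fin.
rewrite /rsum Ep En fineB; last 2 first.
- by rewrite ge0_fin_numE// esum_ge0// => k _; rewrite lee_fin.
- by rewrite ge0_fin_numE// esum_ge0// => k _; rewrite lee_fin.
rewrite (_ : (fun m => symsum m f) = (fun m => symsum m fp - symsum m fn)).
  by apply: cvgB; exact: cvg_symsum_esum.
apply/funext => m; rewrite -symsumB; apply: eq_symsum => k; exact: fpn.
Qed.

(** A telescoping majorant: with t = m + 1, the two new terms add [2 / (1 + t ^+ 2)], at most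
    [4 / t - 4 / (t + 1)]. The value 1 at m = 0 fixes the constant 5. *)
Lemma symsum_inv_sqr m : symsum m (fun k => (1 + k%:~R ^+ 2)^-1) <= 5 - 4 / m.+1%:R :> R.
Proof.
elim: m => [|m IH]; first by rewrite symsum0 expr0n/= addr0 invr1; lra.
rewrite symsumS mulrNz sqrrN; apply: le_trans (lerD IH (lexx _)) _.
rewrite (_ : m.+1%:Z%:~R = m.+1%:R :> R)//.
have mE : m.+2%:R = m.+1%:R + 1 :> R by rewrite natr1.
rewrite mE; have : 0 < m.+1%:R :> R by [].
move: (m.+1%:R : R) => t t0.
suff : (1 + t ^+ 2)^-1 <= 2 / t - 2 / (t + 1) by lra.
have -> : 2 / t - 2 / (t + 1) = 2 / (t * (t + 1)).
  by field; rewrite !gt_eqF//; lra.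
have p1 : 0 < t * (t + 1) by rewrite mulr_gt0//; lra.
have p2 : 0 < 1 + t ^+ 2 by rewrite ltr_pwDl// sqr_ge0.
rewrite -[leLHS]mul1r ler_pdivrMr// mulrAC ler_pdivlMr//.
nra.
Qed.

Lemma summable_inv_sqr (f : int -> R) (C : R) :
  (forall k, `|f k| <= C / (1 + k%:~R ^+ 2)) -> summable [set: int] (EFin \o f).
Proof.
move=> fC; have C0 : 0 <= C.
  by have := le_trans (normr_ge0 _) (fC 0); rewrite expr0n/= addr0 divr1.
rewrite /summable; apply: (@le_lt_trans _ _ (C * 5)%:E); last exact: ltry.
apply: (esum_le_symsum (fun k => `|f k|)) => // m.
apply: (@le_trans _ _ (symsum m (fun k => C * (1 + k%:~R ^+ 2)^-1))).
  by apply: ler_sum.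
rewrite symsumZ ler_wpM2l//; apply: le_trans (symsum_inv_sqr m) _.
by rewrite lerBlDr lerDl divr_ge0.
Qed.

End sums_over_int.

(** * Decay of sinc and absolute convergence *)

Section sinc_decay.
Context {R : realType}.

Lemma sin_norm_le (v : R) : `|sin v| <= `|v|.
Proof.
have := cos_lipschitz (v - pi / 2) (- (pi / 2)).
by rewrite cosBpihalf cosN cos_pihalf subr0 opprK subrK.
Qed.

Lemma sinc_le1 (v : R) : `|sinc v| <= 1.
Proof.
rewrite /sinc; case: eqVneq => [_|v0]; first by rewrite normr1.
have w0 : 0 < `|pi * v| by rewrite normr_gt0 mulf_neq0// gt_eqF// pi_gt0.
by rewrite normrM normfV ler_pdivrMr// mul1r sin_norm_le.
Qed.

Lemma sinc_mul_le1 (v : R) : `|sinc v * v| <= 1.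
Proof.
rewrite /sinc; case: eqVneq => [->|v0]; first by rewrite mulr0 normr0 ler01.
have pi0 := pi_gt0 R; have pi2 := pi_ge2 R.
rewrite (_ : _ * v = sin (pi * v) / pi); last by rewrite invfM -!mulrA mulVf// mulr1.
rewrite normrM normfV (gtr0_norm pi0) ler_pdivrMr// mul1r.
by apply: le_trans (sin_max _) _; lra.
Qed.

(** With [r = a * v + c] one has [r ^+ 2 <= 2 * a ^+ 2 * v ^+ 2 + 2 * c ^+ 2]; both [sinc v ^+ 2]
    and [(sinc v * v) ^+ 2] are at most 1. *)
Lemma sinc_sqr_decay (a c r : R) : 0 < a ->
  sinc ((r - c) / a) ^+ 2 <= (2 * a ^+ 2 + 2 * c ^+ 2 + 1) / (1 + r ^+ 2).
Proof.
move=> a0; set v := (r - c) / a.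
have rE : r = a * v + c by rewrite /v; field; rewrite gt_eqF.
have p : 0 < 1 + r ^+ 2 by rewrite ltr_pwDl// sqr_ge0.
rewrite ler_pdivlMr// rE.
have s1 : sinc v ^+ 2 <= 1.
  by rewrite -real_normK ?num_real// expr_le1// sinc_le1.
have s2 : (sinc v * v) ^+ 2 <= 1.
  by rewrite -real_normK ?num_real// expr_le1// sinc_mul_le1.
have s0 := sqr_ge0 (sinc v).
have : sinc v ^+ 2 * (1 + (a * v + c) ^+ 2) <=
    sinc v ^+ 2 * (2 * c ^+ 2 + 1) + 2 * a ^+ 2 * (sinc v * v) ^+ 2.
  (* (a v + c)^2 + (a v - c)^2 = 2 a^2 v^2 + 2 c^2 *)
  have -> : sinc v ^+ 2 * (2 * c ^+ 2 + 1) + 2 * a ^+ 2 * (sinc v * v) ^+ 2 =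
    sinc v ^+ 2 * (1 + (a * v + c) ^+ 2 + (a * v - c) ^+ 2) by ring.
  by rewrite ler_wpM2l// lerDl sqr_ge0.
move=> h; apply: le_trans h _.
have h1 : sinc v ^+ 2 * (2 * c ^+ 2 + 1) <= 1 * (2 * c ^+ 2 + 1).
  by rewrite ler_wpM2r// addr_ge0// mulr_ge0// sqr_ge0.
have h2 : 2 * a ^+ 2 * (sinc v * v) ^+ 2 <= 2 * a ^+ 2 * 1.
  by rewrite ler_wpM2l// mulr_ge0// sqr_ge0.
lra.
Qed.

Lemma summable_sinc (n : nat) (a c d : R) : 0 < a ->
  summable [set: int] (EFin \o (fun r : int =>
    sinc ((r%:~R - c) / a) ^+ n.+1 * sinc ((r%:~R - d) / a) ^+ n.+1)).
Proof.
(* Since [|sinc|] is at most 1, powers reduce to first powers, and a product is at most half the sum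
   of the squares. The constant is the mean of the two constants of [sinc_sqr_decay]. *)
move=> a0; apply: (summable_inv_sqr _ (2 * a ^+ 2 + c ^+ 2 + d ^+ 2 + 1)) => r.
have h1 := sinc_sqr_decay a c r%:~R a0; have h2 := sinc_sqr_decay a d r%:~R a0.
set u := sinc _ in h1 *; set v := sinc _ in h2 *.
have un : `|u ^+ n.+1| <= `|u|.
  by rewrite normrX exprS ler_piMr// exprn_ile1// sinc_le1.
have vn : `|v ^+ n.+1| <= `|v|.
  by rewrite normrX exprS ler_piMr// exprn_ile1// sinc_le1.
rewrite normrM; apply: le_trans (ler_pM _ _ un vn) _ => //.
have uv : 2 * (`|u| * `|v|) <= u ^+ 2 + v ^+ 2.
  rewrite -(real_normK (num_real u)) -(real_normK (num_real v)).
  by have := sqr_ge0 (`|u| - `|v|); rewrite sqrrB -mulr_natl; lra.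
rewrite -(ler_pM2l (ltr0n R 2)); apply: le_trans uv _; apply: le_trans (lerD h1 h2) _.
rewrite -mulrDl [leRHS]mulrA ler_wpM2r//; last by lra.
by rewrite invr_ge0 addr_ge0// sqr_ge0.
Qed.

End sinc_decay.

(** * Comparison of the two sides and passage to the limit *)

Section conclusion.
Context {R : realType}.
Notation mu := (@lebesgue_measure R).

Lemma fejer_sum_t_poly (n : nat) (a b x : R) (l : int) : 0 < a -> exists C : R,
  forall (k : nat) (e : R), 0 < e ->
  `|a^-1 * (\sum_(m < k) symsum m (fun r : int =>
      sinc ((r%:~R - (x - a * b * l%:~R / 2)) / a) ^+ n.+2
      * sinc ((r%:~R - (x + a * b * l%:~R / 2)) / a) ^+ n.+2))
    - t_poly n.+2 a b l x * k%:R| <= C * (e * k%:R + e^-1).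
Proof.
move=> a0; pose K := Num.truncn (n.+2%:R / a).
(* [D] is the factor from [fejer_bspline] with [m = K]. It does not depend on [y], so the pointwise
   bound can be integrated against [g]. *)
pose D := (2 * K.+1).+1%:R * (a + 2 * pi * `|x + a * b * l%:~R / 2|).
pose g := @bspline R n.+2.
have ig : mu.-integrable setT (EFin \o g) by exact: integrable_bspline.
exists (D * \int[mu]_y g y) => k e e0.
have iS := integrable_bspline_spectral n a b x l k.
have iG := integrable_bspline_sampled n a b x l.
have isk : mu.-integrable setT (EFin \o (fun y => g y * sampled n a b x l y * k%:R)).
  by apply: (integrable_mul_bounded _ _ _ _ _ `|k%:R|).
rewrite -Rintegral_bspline_spectral t_poly_sampled -RintegralZr//.
rewrite -RintegralB// mulrAC -RintegralZl//.
apply: le_trans.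
  by apply: le_normr_Rintegral => //; exact: integrable_Rsub.
apply: le_Rintegral => //.
- by apply: integrable_norm; exact: integrable_Rsub.
- exact: integrable_Rscale.
move=> y _; rewrite -mulrA -mulrBr normrM (ger0_norm (bspline_ge0 _ _)) mulrC.
have [yn|ny] := leP `|y| (n.+2%:R / 2); last by rewrite /g bspline_supp// !mulr0.
rewrite ler_wpM2r ?bspline_ge0// spectral_fejer// /D -[leRHS]mulrA.
have aK : n.+2%:R < a * K.+1%:R by rewrite mulrC -ltr_pdivrMr// truncnS_gt.
exact: (fejer_bspline n a a0 K k y _ _ e aK yn e0).
Qed.

Lemma t_poly_rsum (n : nat) (a b x : R) (l : int) : 0 < a ->
  let F := fun r : int =>
      sinc ((r%:~R - (x - a * b * l%:~R / 2)) / a) ^+ n.+2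
      * sinc ((r%:~R - (x + a * b * l%:~R / 2)) / a) ^+ n.+2 in
  t_poly n.+2 a b l x = a^-1 * rsum F.
Proof.
move=> a0 F; have [C HC] := fejer_sum_t_poly n a b x l a0.
have cF := cvg_symsum_rsum F (summable_sinc n.+1 a _ _ a0).
set t := t_poly _ _ _ _ _ in HC *.
pose v k := `|a^-1 * arithmetic_mean (fun m => symsum m F) k - t|.
have cv : v k @[k --> \oo] --> `|a^-1 * rsum F - t|.
  apply: cvg_norm; apply: cvgB; last exact: cvg_cst.
  by apply: cvgMr; exact: cesaro.
(* For fixed [e] the error divided by the number of terms tends to [C * e]; only afterwards is [e]
   made small. *)
have bound e : 0 < e -> `|a^-1 * rsum F - t| <= C * e.
  move=> e0.
  have cw : C * (e + e^-1 * harmonic k) @[k --> \oo] --> C * (e + e^-1 * 0).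
    by apply: cvgMr; apply: cvgD; [exact: cvg_cst|apply: cvgMr; exact: cvg_harmonic].
  rewrite mulr0 addr0 in cw.
  apply: (ler_cvg_to cv cw); apply: nearW => k.
  have k0 : 0 < k.+1%:R :> R by [].
  rewrite /v /arithmetic_mean /= /series/= big_mkord /harmonic/=.
  (* [arithmetic_mean] at index [k] averages [k + 1] terms. *)
  have := HC k.+1 e e0; set S := \sum_(_ < _) _ => h.
  have -> : a^-1 * (k.+1%:R^-1 * S) - t = (a^-1 * S - t * k.+1%:R) / k.+1%:R.
    by field; rewrite !gt_eqF.
  rewrite normf_div (ger0_norm (ltW k0)) ler_pdivrMr//; apply: le_trans h _.
  by rewrite -mulrA mulrDl -mulrA mulVf ?mulr1// gt_eqF.
apply/eqP; rewrite eq_sym -subr_eq0 -normr_le0 leNgt; apply/negP => d0.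
have C1 : 0 < `|C| + 1 by rewrite ltr_wpDl.
(* This choice of [e] turns [d <= C * e] into [d <= d / 2], impossible for positive [d]. Taking
   [|C| + 1] keeps the denominator positive whatever the value of [C]. *)
have := bound (`|a^-1 * rsum F - t| / (2 * (`|C| + 1))).
move: (`|a^-1 * rsum F - t|) d0 => d d0 h.
have {}h : d <= C * (d / (2 * (`|C| + 1))) by apply: h; rewrite divr_gt0// mulr_gt0.
have : C * (d / (2 * (`|C| + 1))) <= (`|C| + 1) * (d / (2 * (`|C| + 1))).
  rewrite ler_wpM2r ?divr_ge0// ?(ltW d0)// ?mulr_ge0 ?(ltW C1)//.
  by rewrite (le_trans (ler_norm C))// lerDl.
have -> : (`|C| + 1) * (d / (2 * (`|C| + 1))) = d / 2 by field; rewrite gt_eqF.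
lra.
Qed.

End conclusion.

Theorem theorem4p4 (R : realType) (N : nat) (a b : R) (l : int)
    (hN : (2 <= N)%N) (ha : 0 < a) (hb : 0 < b) (hab : a * b < 1) :
  forall x : R, - (1 / 2) <= x <= 1 / 2 ->
    let F := fun r : int =>
      sinc ((r%:~R - (x - a * b * l%:~R / 2)) / a) ^+ N
      * sinc ((r%:~R - (x + a * b * l%:~R / 2)) / a) ^+ N in
    summable [set: int] (fun r => (F r)%:E)
    /\ t_poly N a b l x = 1 / a * rsum F.
Proof.
case: N hN => [|[|n]]// _ x _ F; split; first exact: summable_sinc.
by rewrite div1r; exact: t_poly_rsum.
Qed.
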